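(* Let $n,k$ be integers with $0<k<n$ and let $b\in\mathbb{R}$. Then the function $$\varphi(z)=\frac{1}{2\pi i}\int_{C}\exp\left\{-wz+b\alpha w^{k+1}+\beta w^{n+1}\right\}\,dw,\qquad \alpha=\frac{(-1)^{k+1}}{k+1},\quad \beta=\frac{1}{n+1},$$ is real on the real axis, i.e. $\varphi(x)\in\mathbb{R}$ for all $x\in\mathbb{R}$.
   Context: The contour $C$ runs from $\infty$ to $0$ along the ray $\arg w=-\pi/(n+1)$ and then from $0$ to $\infty$ along the ray $\arg w=\pi/(n+1)$. *)

(* Defs.v *)
From Stdlib Require Import Reals.
From Coquelicot Require Import Coquelicot.
Open Scope R_scope.

(* [cis t] is [e^{it}]. *)
Definition cis (t : R) : C := (cos t, sin t).

Definition Cexp (z : C) : C := (RtoC (exp (Re z)) * cis (Im z))%C.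

(* Pullback of [f(w) dw] along the ray [w = r e^{it}], [r >= 0]; the factor
   [e^{it}] is [dw/dr]. *)
Definition ray_form (t : R) (f : C -> C) (r : R) : C :=
  (f (RtoC r * cis t) * cis t)%C.

Definition contour_angle (n : nat) : R := PI / INR (n + 1).

(* The contour comes in from infinity along the ray of angle
   [- contour_angle n] and leaves along the ray of angle [contour_angle n].
   The integrals are improper Riemann integrals of functions [R -> C]; since
   [RInt_gen] is total, convergence is the separate predicate
   [ex_contour_int]. *)
Definition ex_contour_int (n : nat) (f : C -> C) : Prop :=
  ex_RInt_gen (V := C_R_NormedModule) (ray_form (- contour_angle n) f)
    (Rbar_locally p_infty) (at_point 0)
  /\
  ex_RInt_gen (V := C_R_NormedModule) (ray_form (contour_angle n) f)
    (at_point 0) (Rbar_locally p_infty).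

Definition contour_int (n : nat) (f : C -> C) : C :=
  (RInt_gen (V := C_R_CompleteNormedModule) (ray_form (- contour_angle n) f)
     (Rbar_locally p_infty) (at_point 0)
   +
   RInt_gen (V := C_R_CompleteNormedModule) (ray_form (contour_angle n) f)
     (at_point 0) (Rbar_locally p_infty))%C.

Definition alpha (k : nat) : R := (-1) ^ (k + 1) / INR (k + 1).

Definition beta (n : nat) : R := 1 / INR (n + 1).

Definition integrand (n k : nat) (b : R) (z w : C) : C :=
  Cexp (- (w * z) + RtoC b * RtoC (alpha k) * w ^ (k + 1)
        + RtoC (beta n) * w ^ (n + 1))%C.

Definition phi (n k : nat) (b : R) (z : C) : C :=
  (1 / (2 * RtoC PI * Ci) * contour_int n (integrand n k b z))%C.

(* Main.v *)
(* On both rays [w ^ (n + 1) = - r ^ (n + 1)], and [k + 1 < n + 1], so the modulus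
   of the integrand is eventually at most [exp (- r)] and both integrals converge.
   For real [z] the integrand commutes with conjugation, which exchanges the two
   rays and reverses their orientation: if [l] is the integral along the outgoing
   ray, the incoming one contributes [- Cconj l], and
   [(l - Cconj l) / (2 i PI) = Im l / PI] is real. *)
Require Import Defs.
From Stdlib Require Import Reals Lra Lia.
From Coquelicot Require Import Coquelicot.
Open Scope R_scope.

(** * Comparison test for improper integrals *)

(** Cauchy criterion: two partial integrals from [a] differ by an integral between their upper ends.
    Once both ends exceed [c], this is bounded by the corresponding integral of [g], so the bound
    need only hold from [c] on. *)
Lemma ex_RInt_gen_dominated {V : CompleteNormedModule R_AbsRing}
  (f : R -> V) (g : R -> R) (a c : R) :
  (forall r, continuous f r) -> (forall r, continuous g r) ->
  (forall r, c <= r -> norm (f r) <= g r) ->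
  ex_RInt_gen g (at_point a) (Rbar_locally p_infty) ->
  ex_RInt_gen f (at_point a) (Rbar_locally p_infty).
Proof.
intros cf cg fg ig.
assert (If : forall u v, ex_RInt f u v)
  by (intros; apply ex_RInt_continuous; auto).
assert (Ig : forall u v, ex_RInt g u v)
  by (intros; apply (ex_RInt_continuous (V := R_CompleteNormedModule)); auto).
unfold ex_RInt_gen, is_RInt_gen in *.
(* The criterion for limits of relations asks that each partial integral exist and be unique;
   continuity gives existence. It is used forwards for [f] and, below, backwards for [g]. *)
apply (filterlimi_locally_cauchy (U := CompleteNormedModule.CompleteSpace _ V)
  (F := filter_prod (at_point a) (Rbar_locally p_infty))
  (fun ab => is_RInt f (fst ab) (snd ab))).
{ apply filter_forall; intros [u v]; simpl; split; [apply If|].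
  intros y1 y2 h1 h2.
  now rewrite <- (is_RInt_unique _ _ _ _ h1), <- (is_RInt_unique _ _ _ _ h2). }
intros eps.
assert (Hg : forall u : R * R,
  (exists y : R, is_RInt g (fst u) (snd u) y) /\
  (forall y1 y2 : R, is_RInt g (fst u) (snd u) y1 ->
     is_RInt g (fst u) (snd u) y2 -> y1 = y2)).
{ intros u; split; [apply Ig|]. intros y1 y2 h1 h2.
  now rewrite <- (is_RInt_unique _ _ _ _ h1), <- (is_RInt_unique _ _ _ _ h2). }
destruct (proj2 (filterlimi_locally_cauchy (U := R_CompleteSpace)
  (F := filter_prod (at_point a) (Rbar_locally p_infty))
  (fun ab => is_RInt g (fst ab) (snd ab)) (filter_forall _ Hg)) ig eps)
  as [Pg [FPg HPg]].
exists (fun ab => Pg ab /\ fst ab = a /\ c <= snd ab); split.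
{ apply filter_and; [exact FPg|].
  exists (fun u => u = a) (fun v => c < v).
  - reflexivity.
  - now exists c.
  - simpl; intros x y -> hy; split; [reflexivity|lra]. }
(* The case of ordered upper ends, where the norm of the integral of [f] over [[u, v]] is at most
   the integral of [g]; the other order follows by symmetry of balls. *)
assert (Hle : forall u v : R * R, Pg u -> Pg v -> fst u = a -> fst v = a ->
   c <= snd u -> snd u <= snd v -> forall u' v' : V,
   is_RInt f (fst u) (snd u) u' -> is_RInt f (fst v) (snd v) v' ->
   norm (minus v' u') < eps).
{ intros [u1 u] [v1 v]; simpl; intros Pu Pv -> -> cu uv u' v' hu hv.
  assert (hd : is_RInt f u v (minus v' u')).
  { unfold minus; rewrite plus_comm.
    exact (is_RInt_Chasles f u a v _ _ (is_RInt_swap _ _ _ _ hu) hv). }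
  destruct (Ig a u) as [gu hgu]; destruct (Ig a v) as [gv hgv].
  assert (hgd : is_RInt g u v (minus gv gu)).
  { unfold minus; rewrite plus_comm.
    exact (is_RInt_Chasles g u a v _ _ (is_RInt_swap _ _ _ _ hgu) hgv). }
  apply Rle_lt_trans with (minus gv gu).
  - apply (norm_RInt_le f g u v _ _ uv); [|exact hd|exact hgd].
    intros x hx; apply fg; lra.
  - apply Rle_lt_trans with (Rabs (minus gv gu)); [apply Rle_abs|].
    exact (HPg (a, u) (a, v) Pu Pv gu gv hgu hgv). }
intros u v (Pu & au & cu) (Pv & av & cv) u' v' hu hv.
destruct (Rle_dec (snd u) (snd v)) as [h|h].
- apply (norm_compat1 (V := V) u' v' eps). now apply (Hle u v).
- apply ball_sym, (norm_compat1 (V := V) v' u' eps). apply (Hle v u); trivial. apply Rlt_le, Rnot_le_lt, h.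
Qed.

Lemma ex_RInt_gen_exp_neg (a : R) :
  ex_RInt_gen (fun r => exp (- r)) (at_point a) (Rbar_locally p_infty).
Proof.
(* Limit at infinity minus value at [a] of the antiderivative [- exp (- r)]. *)
exists (0 - - exp (- a)).
apply (is_RInt_gen_ext (Derive (fun r => - exp (- r)))).
{ apply filter_forall; intros ab x _.
  apply is_derive_unique; auto_derive; [easy|ring]. }
apply is_RInt_gen_Derive.
- apply filter_forall; intros ab x _; auto_derive; easy.
- apply filter_forall; intros ab x _.
  apply continuous_ext with (fun r => exp (- r)).
  + intros r; symmetry; apply is_derive_unique; auto_derive; [easy|ring].
  + apply (ex_derive_continuous (fun r => exp (- r))); auto_derive; easy.
- intros P HP. unfold at_point, filtermap. now apply locally_singleton.
- replace (locally 0) with (Rbar_locally (Rbar_opp (Finite 0)))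
    by (simpl; now rewrite Ropp_0).
  apply (is_lim_opp (fun r => exp (- r)) p_infty 0).
  apply is_lim_comp with m_infty.
  + exact is_lim_exp_m.
  + exact (is_lim_opp (fun r => r) p_infty p_infty (is_lim_id p_infty)).
  + now exists 0.
Qed.

(** * Conjugation of improper integrals *)

(** Conjugation is an [R]-linear isometry, so it passes through partial integrals and their limit;
    the minus sign comes from exchanging the endpoints. *)
Lemma is_RInt_gen_Cconj_swap (Fa Fb : (R -> Prop) -> Prop)
  {HFa : Filter Fa} {HFb : Filter Fb} (f : R -> C) (l : C) :
  is_RInt_gen (V := C_R_NormedModule) f Fa Fb l ->
  is_RInt_gen (V := C_R_NormedModule) (fun r => Cconj (f r)) Fb Fa
    (- Cconj l)%C.
Proof.
intros H. apply (is_RInt_gen_swap (V := C_R_NormedModule)).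
unfold is_RInt_gen in *.
apply filterlimi_locally; intros eps.
generalize (proj1 (filterlimi_locally _ _) H eps).
apply filter_imp; intros ab [y [hy by_]].
exists (Cconj y); split.
- apply (is_RInt_fct_extend_pair (U := R_NormedModule) (V := R_NormedModule)).
  + exact (is_RInt_fct_extend_fst (U := R_NormedModule) (V := R_NormedModule)
             _ _ _ _ hy).
  + apply (is_RInt_opp (V := R_NormedModule)).
    exact (is_RInt_fct_extend_snd (U := R_NormedModule) (V := R_NormedModule)
             _ _ _ _ hy).
- destruct by_ as [b1 b2]; split; simpl in *.
  + exact b1.
  + unfold ball, AbsRing_ball, minus, plus, opp, abs in *; simpl in *.
    unfold AbsRing_ball, minus, plus, opp, abs in *; simpl in *.
    rewrite <- Rabs_Ropp.
    match goal with |- Rabs ?x < _ =>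
      replace x with (snd y + - snd l) by ring end; exact b2.
Qed.

(** * Continuity of the integrand along a ray *)

(* Coquelicot's product rule for [C] is stated for the topology of [C] as an
   absolute ring, whereas the integrals use the product topology of [R * R];
   working with the two real parts avoids the transfer. *)
Definition continuous_parts (f : R -> C) (x : R) : Prop :=
  continuous (fun r => Re (f r)) x /\ continuous (fun r => Im (f r)) x.

Lemma continuous_parts_continuous (f : R -> C) (x : R) :
  continuous_parts f x -> continuous (U := C_R_NormedModule) f x.
Proof.
intros [h1 h2]. apply filterlim_locally; intros eps.
generalize (filter_and _ _ (proj1 (filterlim_locally _ _) h1 eps)
                           (proj1 (filterlim_locally _ _) h2 eps)).
apply filter_imp; intros r [b1 b2]; split; assumption.
Qed.

Lemma continuous_parts_const (c : C) (x : R) : continuous_parts (fun _ => c) x.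
Proof. split; apply continuous_const. Qed.

Lemma continuous_parts_RtoC (x : R) : continuous_parts RtoC x.
Proof. split; [apply continuous_id|apply continuous_const]. Qed.

Lemma continuous_parts_plus (f g : R -> C) (x : R) :
  continuous_parts f x -> continuous_parts g x ->
  continuous_parts (fun r => f r + g r)%C x.
Proof.
intros [f1 f2] [g1 g2]; split;
  apply (continuous_plus (V := R_NormedModule)); assumption.
Qed.

Lemma continuous_parts_opp (f : R -> C) (x : R) :
  continuous_parts f x -> continuous_parts (fun r => - f r)%C x.
Proof.
intros [f1 f2]; split; apply (continuous_opp (V := R_NormedModule)); assumption.
Qed.

Lemma continuous_parts_mult (f g : R -> C) (x : R) :
  continuous_parts f x -> continuous_parts g x ->
  continuous_parts (fun r => f r * g r)%C x.
Proof.
intros [f1 f2] [g1 g2]; split; simpl.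
- apply (continuous_minus (V := R_NormedModule));
    apply (continuous_mult (K := R_AbsRing)); assumption.
- apply (continuous_plus (V := R_NormedModule));
    apply (continuous_mult (K := R_AbsRing)); assumption.
Qed.

Lemma continuous_parts_pow (f : R -> C) (m : nat) (x : R) :
  continuous_parts f x -> continuous_parts (fun r => f r ^ m)%C x.
Proof.
intros hf; induction m as [|m IH]; [apply continuous_parts_const|].
now apply (continuous_parts_mult f (fun r => f r ^ m)%C).
Qed.

Lemma continuous_parts_Cexp (f : R -> C) (x : R) :
  continuous_parts f x -> continuous_parts (fun r => Cexp (f r)) x.
Proof.
intros [f1 f2].
apply (continuous_parts_mult (fun r => RtoC (exp (Re (f r))))
         (fun r => cis (Im (f r)))); split; simpl.
- now apply continuous_exp_comp.
- apply continuous_const.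
- now apply continuous_cos_comp.
- now apply continuous_sin_comp.
Qed.

Lemma continuous_ray_form (t : R) (n k : nat) (b : R) (z : C) (r : R) :
  continuous_parts (ray_form t (integrand n k b z)) r.
Proof.
assert (hw : continuous_parts (fun r => RtoC r * cis t)%C r)
  by apply (continuous_parts_mult RtoC (fun _ => cis t)
              r (continuous_parts_RtoC r) (continuous_parts_const _ r)).
assert (hm : forall (c : C) m,
  continuous_parts (fun r => c * (RtoC r * cis t) ^ m)%C r).
{ intros c m.
  apply (continuous_parts_mult (fun _ => c) (fun r => (RtoC r * cis t) ^ m)%C).
  - apply continuous_parts_const.
  - now apply (continuous_parts_pow (fun r => RtoC r * cis t)%C). }
apply (continuous_parts_mult
         (fun r => integrand n k b z (RtoC r * cis t)) (fun _ => cis t));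
  [|apply continuous_parts_const].
apply (continuous_parts_Cexp (fun r => - (RtoC r * cis t * z)
  + RtoC b * RtoC (alpha k) * (RtoC r * cis t) ^ (k + 1)
  + RtoC (beta n) * (RtoC r * cis t) ^ (n + 1))%C).
apply (continuous_parts_plus (fun r => - (RtoC r * cis t * z)
  + RtoC b * RtoC (alpha k) * (RtoC r * cis t) ^ (k + 1))%C
  (fun r => RtoC (beta n) * (RtoC r * cis t) ^ (n + 1))%C); [|apply hm].
apply (continuous_parts_plus (fun r => - (RtoC r * cis t * z))%C
  (fun r => RtoC b * RtoC (alpha k) * (RtoC r * cis t) ^ (k + 1))%C);
  [|apply hm].
apply (continuous_parts_opp (fun r => RtoC r * cis t * z)%C).
apply (continuous_parts_mult (fun r => RtoC r * cis t)%C (fun _ => z));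
  [exact hw|apply continuous_parts_const].
Qed.

(** * Modulus and conjugate of the complex exponential *)

Lemma Cmod_cis (t : R) : Cmod (cis t) = 1.
Proof.
unfold Cmod, cis; simpl fst; simpl snd.
rewrite <- !Rsqr_pow2, Rplus_comm, sin2_cos2; apply sqrt_1.
Qed.

Lemma Cmod_Cexp (z : C) : Cmod (Cexp z) = exp (Re z).
Proof.
unfold Cexp. rewrite Cmod_mult, Cmod_cis, Cmod_R, Rmult_1_r.
apply Rabs_pos_eq, Rlt_le, exp_pos.
Qed.

Lemma cis_pow (t : R) (m : nat) : (cis t ^ m)%C = cis (INR m * t).
Proof.
induction m as [|m IH].
- unfold cis; simpl; now rewrite Rmult_0_l, cos_0, sin_0.
- simpl Cpow; rewrite IH, S_INR.
  replace ((INR m + 1) * t) with (t + INR m * t) by ring.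
  unfold cis, Cmult; simpl; rewrite cos_plus, sin_plus; f_equal; ring.
Qed.

Lemma Cconj_cis (t : R) : Cconj (cis t) = cis (- t).
Proof. unfold Cconj, cis; simpl; now rewrite cos_neg, sin_neg. Qed.

Lemma Cconj_RtoC (x : R) : Cconj (RtoC x) = RtoC x.
Proof. unfold Cconj, RtoC; simpl; now rewrite Ropp_0. Qed.

Lemma Cconj_Cexp (z : C) : Cconj (Cexp z) = Cexp (Cconj z).
Proof.
unfold Cexp. now rewrite Cmult_conj, Cconj_RtoC, Cconj_cis, re_conj, im_conj.
Qed.

(** All coefficients of the exponent, including [x], are real, so conjugation acts only on [w] and
    on the factor [cis t], turning [t] into [- t] in both. *)
Lemma Cconj_ray_form (t : R) (n k : nat) (b x r : R) :
  Cconj (ray_form t (integrand n k b (RtoC x)) r)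
  = ray_form (- t) (integrand n k b (RtoC x)) r.
Proof.
unfold ray_form, integrand.
now rewrite Cmult_conj, Cconj_Cexp, !Cplus_conj, Copp_conj, !Cmult_conj,
  !Cpow_conj, !Cmult_conj, !Cconj_cis, !Cconj_RtoC.
Qed.

(** * Decay of the integrand and convergence *)

(** For [r >= 1], [r <= r ^ (k + 1)] and [r * r ^ (k + 1) <= r ^ (n + 1)]. Once also
    [c * r >= A + 1 + B], the top term is at least [(A + 1 + B) * r ^ (k + 1)], which absorbs
    [A * r], [r] and [B * r ^ (k + 1)]. *)
Lemma poly_growth (A B c : R) (k n : nat) :
  0 <= A -> 0 <= B -> 0 < c -> (k < n)%nat ->
  exists r0, 0 <= r0 /\ forall r, r0 <= r ->
    A * r + B * r ^ (k + 1) - c * r ^ (n + 1) <= - r.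
Proof.
intros hA hB hc hkn.
exists (Rmax 1 ((A + 1 + B) / c)); split.
{ apply Rle_trans with 1; [lra|apply Rmax_l]. }
intros r hr.
assert (r1 : 1 <= r) by (eapply Rle_trans; [apply Rmax_l|exact hr]).
assert (r2 : A + 1 + B <= c * r).
{ assert (h : (A + 1 + B) / c <= r)
    by (eapply Rle_trans; [apply Rmax_r|exact hr]).
  apply Rmult_le_compat_l with (r := c) in h; [|lra].
  replace (c * ((A + 1 + B) / c)) with (A + 1 + B) in h by (field; lra).
  exact h. }
assert (h1 : r <= r ^ (k + 1)).
{ rewrite <- (pow_1 r) at 1. apply Rle_pow; [lra|lia]. }
assert (h2 : r * r ^ (k + 1) <= r ^ (n + 1)).
{ change (r ^ S (k + 1) <= r ^ (n + 1)). apply Rle_pow; [lra|lia]. }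
assert (h3 : (A + 1 + B) * r ^ (k + 1) <= c * r * r ^ (k + 1))
  by (apply Rmult_le_compat_r; lra).
assert (h4 : c * (r * r ^ (k + 1)) <= c * r ^ (n + 1))
  by (apply Rmult_le_compat_l; lra).
assert (h5 : (A + 1) * r <= (A + 1) * r ^ (k + 1))
  by (apply Rmult_le_compat_l; lra).
lra.
Qed.

Lemma Re_le_Cmod (z : C) : Re z <= Cmod z.
Proof. eapply Rle_trans; [apply Rle_abs|apply re_le_Cmod]. Qed.

(* The cosine hypothesis says that [w ^ (n + 1)] has real part [- r ^ (n + 1)] on
   the ray; it holds at [t = contour_angle n] and [t = - contour_angle n]. *)
Lemma norm_ray_form_le (t : R) (n k : nat) (b : R) (z : C) (r : R) :
  cos (INR (n + 1) * t) = - 1 -> 0 <= r ->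
  norm (V := C_R_NormedModule) (ray_form t (integrand n k b z) r) <=
  exp (Cmod z * r + Rabs (b * alpha k) * r ^ (k + 1) - beta n * r ^ (n + 1)).
Proof.
intros ht hr.
(* The product norm on pairs of reals is Euclidean, hence the modulus. *)
assert (E : forall v : C, norm (V := C_R_NormedModule) v = Cmod v).
{ intros v. unfold Cmod.
  change (sqrt (Rabs (fst v) ^ 2 + Rabs (snd v) ^ 2)
          = sqrt (fst v ^ 2 + snd v ^ 2)).
  now rewrite !pow2_abs. }
rewrite E. unfold ray_form, integrand.
rewrite Cmod_mult, Cmod_cis, Rmult_1_r, Cmod_Cexp.
assert (mw : Cmod (RtoC r * cis t) = r)
  by (rewrite Cmod_mult, Cmod_cis, Cmod_R, Rabs_pos_eq; lra).
assert (h1 : Re (- (RtoC r * cis t * z))%C <= Cmod z * r).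
{ eapply Rle_trans; [apply Re_le_Cmod|].
  rewrite Cmod_opp, Cmod_mult, mw; lra. }
assert (h2 : Re (RtoC b * RtoC (alpha k) * (RtoC r * cis t) ^ (k + 1))%C
             <= Rabs (b * alpha k) * r ^ (k + 1)).
{ eapply Rle_trans; [apply Re_le_Cmod|].
  rewrite Cmod_mult, Cmod_pow, mw, <- RtoC_mult, Cmod_R; lra. }
assert (h3 : Re (RtoC (beta n) * (RtoC r * cis t) ^ (n + 1))%C
             = - (beta n * r ^ (n + 1))).
{ rewrite Cpow_mult_l, cis_pow, <- RtoC_pow.
  unfold Re, cis, RtoC, Cmult; simpl fst; simpl snd. rewrite ht; ring. }
set (z1 := (- (RtoC r * cis t * z))%C) in *.
set (z2 := (RtoC b * _ * _)%C) in *.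
set (z3 := (RtoC (beta n) * _)%C) in *.
change (Re (z1 + z2 + z3)%C) with (Re z1 + Re z2 + Re z3).
match goal with |- exp ?u <= exp ?v =>
  destruct (Rle_lt_or_eq_dec u v) as [h|h] end.
- lra.
- now apply Rlt_le, exp_increasing.
- now rewrite h; apply Rle_refl.
Qed.

(** From the [r0] of [poly_growth] on, the exponent bounding the norm is at most [- r], so
    [exp (- r)] dominates. *)
Lemma ex_RInt_gen_ray_form (t : R) (n k : nat) (b : R) (z : C) :
  (k < n)%nat -> cos (INR (n + 1) * t) = - 1 ->
  ex_RInt_gen (V := C_R_NormedModule) (ray_form t (integrand n k b z))
    (at_point 0) (Rbar_locally p_infty).
Proof.
intros hkn ht.
assert (hbeta : 0 < beta n).
{ unfold beta. apply Rdiv_lt_0_compat; [lra|apply lt_0_INR; lia]. }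
destruct (poly_growth (Cmod z) (Rabs (b * alpha k)) (beta n) k n)
  as [r0 [hr0 hr]]; trivial; [apply Cmod_ge_0|apply Rabs_pos|].
apply (ex_RInt_gen_dominated (V := C_R_CompleteNormedModule) _
         (fun r => exp (- r)) 0 r0).
- intros r; apply continuous_parts_continuous, continuous_ray_form.
- intros r; apply (ex_derive_continuous (fun r => exp (- r))); auto_derive; easy.
- intros r h. eapply Rle_trans; [apply norm_ray_form_le; [exact ht|lra]|].
  destruct (hr r h) as [h'|h'].
  + now apply Rlt_le, exp_increasing.
  + rewrite h'; apply Rle_refl.
- apply ex_RInt_gen_exp_neg.
Qed.

(** * The two rays combined *)

Lemma cos_contour_angle (n : nat) : cos (INR (n + 1) * contour_angle n) = - 1.
Proof.
unfold contour_angle.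
replace (INR (n + 1) * (PI / INR (n + 1))) with PI; [exact cos_PI|].
field. apply not_0_INR; lia.
Qed.

Theorem theorem5 :
  forall (n k : nat) (b : R),
    (0 < k < n)%nat ->
    (forall z : C, ex_contour_int n (integrand n k b z)) /\
    (forall x : R, Im (phi n k b (RtoC x)) = 0).
Proof.
intros n k b [_ hkn]; split.
- intros z; split.
  + destruct (ex_RInt_gen_ray_form (- contour_angle n) n k b z hkn) as [l hl].
    { rewrite Ropp_mult_distr_r_reverse, cos_neg; apply cos_contour_angle. }
    (* This ray is traversed from infinity to [0], hence the opposite value. *)
    exists (opp l). now apply (is_RInt_gen_swap (V := C_R_NormedModule)).
  + apply ex_RInt_gen_ray_form; [exact hkn|apply cos_contour_angle].
- intros x.
  destruct (ex_RInt_gen_ray_form (contour_angle n) n k b (RtoC x) hkn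
              (cos_contour_angle n)) as [l hl].
  assert (hl' := is_RInt_gen_Cconj_swap _ _ _ _ hl).
  (* The conjugated form is the form on the incoming ray, so [hl'] becomes the value [- Cconj l]
     there. *)
  apply (is_RInt_gen_ext (V := C_R_NormedModule) _
           (ray_form (- contour_angle n) (integrand n k b (RtoC x)))) in hl'.
  2: { apply filter_forall; intros ab r _; apply Cconj_ray_form. }
  unfold phi, contour_int.
  rewrite (is_RInt_gen_unique (V := C_R_CompleteNormedModule) _ _ hl),
          (is_RInt_gen_unique (V := C_R_CompleteNormedModule) _ _ hl').
  replace (1 / (2 * RtoC PI * Ci) * (- Cconj l + l))%C with (RtoC (Im l / PI)).
  { reflexivity. }
  (* The factor [2 * Ci] cancels against the prefactor, leaving the real number [Im l / PI]. *)
  replace (- Cconj l + l)%C with (2 * Ci * Im l)%C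
    by (rewrite <- im_alt'; ring).
  assert (hpi := PI_neq0).
  assert (hpiC : RtoC PI <> 0%C) by (intros h; apply RtoC_inj in h; easy).
  assert (hi : Ci <> 0%C) by (intros h; inversion h; lra).
  assert (h2 : (2 : C) <> 0%C) by (intros h; apply RtoC_inj in h; lra).
  rewrite RtoC_div by exact hpi. field; auto.
Qed.
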